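(* Let $R$ be a unitary ring with involution $*$, let $a\in R$ and $m\in\mathbb{N}$. Then $a$ is $m$-weak group invertible if and only if there exist $x\in R$ and $k\in\mathbb{N}^{+}$ such that $$xa^{k+1}=a^{k},\qquad ax^{2}=x,\qquad \left((a^{m})^{*}a^{m+1}x\right)^{*}=(a^{m})^{*}a^{m+1}x.$$
   Context: $R$ is an associative ring with identity $1$ equipped with an involution, i.e. a map $a\mapsto a^{*}$ with $(a+b)^{*}=a^{*}+b^{*}$, $(ab)^{*}=b^{*}a^{*}$, $(a^{*})^{*}=a$ for all $a,b\in R$. $\mathbb{N}$ is the set of nonnegative integers, $\mathbb{N}^{+}$ the set of positive integers, and $a^{0}=1$ for every $a\in R$. $m$-weak group inverse: for $a\in R$ and $m\in\mathbb{N}$, an element $x\in R$ is called an $m$-weak group inverse of $a$ if there exists $k\in\mathbb{N}^{+}$ such that $xa^{k+1}=a^{k}$, $ax^{2}=x$, and $(a^{k})^{*}a^{m+1}x=(a^{k})^{*}a^{m}$. $a$ is $m$-weak group invertible if it has at least one $m$-weak group inverse. *)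

(* Defs.v *)
From mathcomp Require Import all_boot all_order all_algebra.

Set Implicit Arguments.
Unset Strict Implicit.
Unset Printing Implicit Defensive.

Import GRing.Theory.
Local Open Scope ring_scope.

(* The base structure is pzRingType, so the zero ring is allowed. *)
Record ring_involution (R : pzRingType) (star : R -> R) : Prop :=
  RingInvolution {
    starD : forall a b : R, star (a + b) = star a + star b;
    starM : forall a b : R, star (a * b) = star b * star a;
    starK : forall a : R, star (star a) = a
  }.

Definition weak_group_inverse (R : pzRingType) (star : R -> R)
    (m : nat) (a x : R) : Prop :=
  exists k : nat,
    [/\ (0 < k)%N,
        x * a ^+ k.+1 = a ^+ k,
        a * x ^+ 2 = x
      & star (a ^+ k) * a ^+ m.+1 * x = star (a ^+ k) * a ^+ m].

Definition weak_group_invertible (R : pzRingType) (star : R -> R)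
    (m : nat) (a : R) : Prop :=
  exists x : R, weak_group_inverse star m a x.

(* Main.v *)
Require Import Defs.
From mathcomp Require Import all_boot all_order all_algebra.

(** Let [p := a * x].  The equations [x * a ^+ k.+1 = a ^+ k] and
    [a * x ^+ 2 = x] make [p] an idempotent generating the right ideal of
    [a ^+ k]: indeed [a ^+ k * x ^+ k = p] ([expr_mul_outer]) and
    [p * a ^+ k = a ^+ k] ([outer_mul_expr]).  With [b := a ^+ m], the third
    equation of an m-weak group inverse says that [b * (1 - p)] is orthogonal
    to [a ^+ k], while the symmetry of [star b * b * p] amounts to
    [star (b * p) * b * (1 - p) = 0], that is, to the orthogonality of
    [b * (1 - p)] and [b * p] ([star_symmetric_idempotent]).

    Orthogonality to [a ^+ k] passes to [b * p], because
    [b * p = a ^+ k * (b * x ^+ k)].  Conversely, orthogonality to [b * p] passes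
    to [a ^+ (m + k) = b * p * a ^+ k], so the exponent grows from [k] to
    [m + k], which the existential over [k] permits.  The same [x] therefore
    serves in both directions. *)

Set Implicit Arguments.
Unset Strict Implicit.
Unset Printing Implicit Defensive.

Import GRing.Theory.
Local Open Scope ring_scope.

(** Since [x = a * x * x], each new factor [a] on the left is paid for by one
    factor [x] on the right.  The exponents are shifted because [a * x] need
    not be [1]. *)
Lemma expr_mul_outer (R : pzRingType) (a x : R) :
  a * x ^+ 2 = x -> forall n, a ^+ n.+1 * x ^+ n.+1 = a * x.
Proof.
move=> ax2; elim=> [|n IHn]; first by rewrite !expr1.
have axx : a * x ^+ n.+2 = x ^+ n.+1.
  by rewrite -[n.+2]add2n exprD mulrA ax2 -exprS.
by rewrite exprSr -mulrA axx.
Qed.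

(** Here [x = a ^+ k.+1 * x ^+ k.+2], so [a ^+ k = x * a ^+ k.+1] is also a
    right multiple of [a ^+ k.+1]; left multiplication by [a * x] fixes
    [a ^+ k.+1], hence all its right multiples. *)
Lemma outer_mul_expr (R : pzRingType) (a x : R) (k : nat) :
  x * a ^+ k.+1 = a ^+ k -> a * x ^+ 2 = x -> a * x * a ^+ k = a ^+ k.
Proof.
move=> xak ax2.
have ak : a ^+ k = a ^+ k.+1 * (x ^+ k.+2 * a ^+ k.+1).
  have axx : a ^+ k.+1 * x ^+ k.+2 = x.
    by rewrite [x ^+ _]exprSr mulrA expr_mul_outer // -mulrA -expr2.
  by rewrite mulrA axx xak.
by rewrite {1}ak mulrA -(mulrA a x) xak -exprS -ak.
Qed.

(** For a self-adjoint [h], compressing by the idempotent [p] on both sides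
    yields a self-adjoint element, so one-sided compression is self-adjoint
    exactly when it agrees with the two-sided one.  The agreement is stated
    in its adjoint form, which reads as an orthogonality relation. *)
Lemma star_symmetric_idempotent (R : pzRingType) (star : R -> R)
    (star_inv : ring_involution star) (h p : R) :
  star h = h -> p * p = p ->
  (star (h * p) = h * p <-> star p * h * p = star p * h).
Proof.
case: star_inv => _ sM sK sh pp; split=> [|php].
  by rewrite sM sh => ->; rewrite -mulrA pp.
have: star (star p * h * p) = star (star p * h) by rewrite php.
by rewrite !sM sK sh mulrA php.
Qed.

Lemma outer_idempotent (R : pzRingType) (a x : R) (k : nat) :
  (0 < k)%N -> x * a ^+ k.+1 = a ^+ k -> a * x ^+ 2 = x ->
  a * x * (a * x) = a * x.
Proof.
case: k => // k _ xak ax2.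
by rewrite -{2}(expr_mul_outer ax2 k) mulrA outer_mul_expr // expr_mul_outer.
Qed.

Theorem proposition4p2 (R : pzRingType) (star : R -> R)
    (star_inv : ring_involution star) (a : R) (m : nat) :
  weak_group_invertible star m a <->
  exists (x : R) (k : nat),
    [/\ (0 < k)%N,
        x * a ^+ k.+1 = a ^+ k,
        a * x ^+ 2 = x
      & star (star (a ^+ m) * a ^+ m.+1 * x) = star (a ^+ m) * a ^+ m.+1 * x].
Proof.
have [_ sM sK] := star_inv.
have shift (c x : R) : c * a ^+ m.+1 * x = c * a ^+ m * (a * x).
  by rewrite exprSr !mulrA.
have sh : star (star (a ^+ m) * a ^+ m) = star (a ^+ m) * a ^+ m.
  by rewrite sM sK.
split=> [[x [k [k_gt0 xak ax2 weak]]] | [x [k [k_gt0 xak ax2]]]].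
  exists x, k; split=> //; rewrite shift.
  apply/(star_symmetric_idempotent star_inv sh (outer_idempotent k_gt0 xak ax2)).
  have bp : star (a * x) * star (a ^+ m)
          = star (a ^+ m * x ^+ k) * star (a ^+ k).
    rewrite -!sM [a ^+ k * _]mulrA -exprD addnC exprD -mulrA.
    by case: k k_gt0 {xak weak} => // k _; rewrite expr_mul_outer.
  rewrite (mulrA (star (a * x))) bp -!mulrA; congr (_ * _).
  by rewrite (mulrA (a ^+ m)) -exprSr !mulrA.
rewrite shift.
move/(star_symmetric_idempotent star_inv sh (outer_idempotent k_gt0 xak ax2)).
move=> orth; exists x, (m + k)%N; split=> //.
- by rewrite addn_gt0 k_gt0 orbT.
- by rewrite addnC -addSn exprD mulrA xak -exprD.
(* [a ^+ (m + k) = b * p * a ^+ k] for [b = a ^+ m] and [p = a * x]. *)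
have sak : star (a ^+ (m + k))
         = star (a ^+ k) * (star (a * x) * star (a ^+ m)).
  by rewrite -!sM -mulrA outer_mul_expr // exprD.
rewrite shift sak -!mulrA; congr (_ * _).
by move: orth; rewrite -!mulrA.
Qed.
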